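(* Let $\Delta$ be an abstract polyhedral complex with a recession fan. Then the tropical function field $\operatorname{Rat}(|\Delta|)$ is finitely generated as a semifield over $\mathbb T\mathbb Q$.
   Context: Abstract polyhedral complex with recession fan. Let $V_f\neq\emptyset$ and $V_\infty$ be disjoint finite sets. Let $\Pi$ be a finite poset with a map $\zeta\colon\Pi\to2^{V_f\cup V_\infty}$ such that: (1) $\Pi$ has a minimum $\hat0$ with $\zeta(\hat0)=\emptyset$; (2) for each $x\in V_f\cup V_\infty$ there is a unique $\tau\in\Pi$ with $\zeta(\tau)=\{x\}$; (3) for each $\tau$, $\zeta$ restricts to a bijection from the interval $[\hat0,\tau]$ onto the poset of subsets of $\zeta(\tau)$. Then $\Delta=\{\tau\in\Pi:\zeta(\tau)\cap V_f\neq\emptyset\}$ is an abstract polyhedral complex with recession fan $\Upsilon=\Pi\setminus\Delta$. To $\tau\in\Delta$ with $\zeta(\tau)=A\cup B$ ($A\subseteq V_f$, $B\subseteq V_\infty$) attach $\Theta_\tau=\sigma^A\times\mathbb R^B_{\ge0}\subseteq\mathbb R^{A\cup B}$, $\sigma^A=\{u\in\mathbb R^A_{\ge0}:\sum u_v=1\}$, with integral structure from $\mathbb Z^{A\cup B}$; for $\tau\preceq\eta$, $\Theta_\tau$ is glued as the corresponding face of $\Theta_\eta$; the result is the support $|\Delta|$. Similarly $|\Upsilon|$ is obtained by gluing cones $\mathbb R^{\zeta(\tau)}_{\ge0}$, $\tau\in\Upsilon$, and the recession cone of $\Theta_\tau$ is the cone of the element of $\Upsilon$ below $\tau$ with $\zeta$-value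 $\zeta(\tau)\cap V_\infty$. A half-line $\{p+tw:t\ge 0\}\subseteq\Theta_\tau$ with $0\ne w\in\mathbb R^{B}_{\ge0}$ determines the half-line $\mathbb R_{\ge0}w$ of $|\Upsilon|$ in that cone; two half-lines of $|\Delta|$ are parallel if they determine the same half-line of $|\Upsilon|$. The slope near infinity of a piecewise affine $F$ along $\{p+tw\}$ is $\frac{d}{dt}F(p+tw)$ for $t\gg0$. An integral $\mathbb Q$-affine function on a polyhedron in $\mathbb R^N$ is the restriction of $u\mapsto\langle m,u\rangle+\gamma$ with $m\in\mathbb Z^N$, $\gamma\in\mathbb Q$. $\operatorname{Rat}(|\Delta|)$ consists of $\infty$ and all continuous $F\colon|\Delta|\to\mathbb R$ which are integral $\mathbb Q$-affine on each piece of some subdivision of the $\Theta_\tau$ into integral $\mathbb Q$-affine polyhedra compatible along faces, and which have the same slope near infinity along any two parallel half-lines; it is a semifield with $F\oplus G=\min(F,G)$, $F\odot G=F+G$. $\mathbb T\mathbb Q=\mathbb Q\cup\{\infty\}$ with $\oplus=\min$, $\odot=+$; it embeds in $\operatorname{Rat}(|\Delta|)$ as constants. A semifield $S$ over $\mathbb T\mathbb Q$ is finitely generated if there are $s_1,\dots,s_r\in S$ such that every element of $S$ is of the form $p(s_1,\dots,s_r)\odot q(s_1,\dots,s_r)^{-1}$ with $p,q$ tropical polynomials (finite $\oplus$-sums of terms $a\odot s_1^{\odot i_1}\odot\cdots\odot s_r^{\odot i_r}$, $a\in\mathbb T\mathbb Q$), $q\neq\infty$. *)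

(* Defs.v *)
From HB Require Import structures.
From mathcomp Require Import all_boot all_order all_algebra.
From mathcomp Require Import reals.

Set Implicit Arguments.
Unset Strict Implicit.
Unset Printing Implicit Defensive.

Import Order.TTheory GRing.Theory Num.Theory.
Local Open Scope ring_scope.

Section APC.
Variables (R : realType) (d : Order.disp_t) (P : finPOrderType d)
  (V : finType) (Vf : {set V}) (zeta : P -> {set V}).
(* V = V_f \sqcup V_oo : the finite type V is the disjoint union, with
   V_f = Vf and V_oo = ~: Vf. *)

Definition is_APC_with_fan : Prop :=
  [/\ Vf != set0,
      exists z : P, (forall x : P, (z <= x)%O) /\ zeta z = set0,
      forall x : V, exists! t : P, zeta t = [set x] &
      forall t : P,
        [/\ forall r1 r2 : P, (r1 <= t)%O -> (r2 <= t)%O ->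
              zeta r1 = zeta r2 -> r1 = r2,
            forall r1 r2 : P, (r1 <= t)%O -> (r2 <= t)%O ->
              (r1 <= r2)%O = (zeta r1 \subset zeta r2),
            forall r : P, (r <= t)%O -> zeta r \subset zeta t &
            forall S : {set V}, S \subset zeta t ->
              exists2 r : P, (r <= t)%O & zeta r = S]].

Definition inDelta (t : P) : bool := zeta t :&: Vf != set0.

(* Theta_t = sigma^A x R^B_{>=0}, realised inside R^V (coordinates outside
   zeta t are zero); faces Theta_r, r <= t, are then literal subsets. *)
Definition inTheta (t : P) (u : V -> R) : Prop :=
  [/\ forall v, v \notin zeta t -> u v = 0,
      forall v, v \in zeta t -> 0 <= u v &
      \sum_(v in zeta t :&: Vf) u v = 1].

(* A function on |Delta| = a family of functions on the Theta_t, compatible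
   with the gluing along faces. *)
Definition fam := P -> (V -> R) -> R.

Definition in_poly (Q : seq ((V -> rat) * rat)) (u : V -> R) : bool :=
  all (fun c => \sum_v ratr (c.1 v) * u v <= ratr c.2) Q.

Definition int_affine (m : V -> int) (g : rat) (u : V -> R) : R :=
  \sum_v (m v)%:~R * u v + ratr g.

Definition compatible (F : fam) : Prop :=
  forall r t : P, inDelta r -> inDelta t -> (r <= t)%O ->
    forall u, inTheta r u -> F t u = F r u.

Definition piecewise_int_affine (F : fam) : Prop :=
  forall t : P, inDelta t ->
    exists n : nat, exists Q : 'I_n -> seq ((V -> rat) * rat),
    exists m : 'I_n -> V -> int, exists g : 'I_n -> rat,
      (forall u, inTheta t u -> exists i : 'I_n, in_poly (Q i) u) /\
      (forall (i : 'I_n) u, inTheta t u -> in_poly (Q i) u ->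
          F t u = int_affine (m i) (g i) u).

Definition shift (p w : V -> R) (s : R) : V -> R := fun v => p v + s * w v.

Definition halfline (t : P) (p w : V -> R) : Prop :=
  [/\ inDelta t, inTheta t p, forall v, 0 <= w v, exists v, w v != 0 &
      forall v, w v != 0 -> (v \in zeta t) && (v \notin Vf)].

Definition slope_at_infty (F : fam) (t : P) (p w : V -> R) (sigma : R) : Prop :=
  exists T : R, 0 <= T /\
    forall s : R, T <= s -> F t (shift p w s) = F t (shift p w T) + sigma * (s - T).

(* the half-lines along w in Theta_t1 and Theta_t2 determine the same
   half-line R_{>=0} w of |Upsilon| : w lies in a common face of both. *)
Definition same_direction (t1 t2 : P) (w : V -> R) : Prop :=
  exists r : P, [/\ (r <= t1)%O, (r <= t2)%O & forall v, w v != 0 -> v \in zeta r].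

Definition equal_slopes (F : fam) : Prop :=
  forall (t1 t2 : P) (p1 p2 w : V -> R) (s1 s2 : R),
    halfline t1 p1 w -> halfline t2 p2 w -> same_direction t1 t2 w ->
    slope_at_infty F t1 p1 w s1 -> slope_at_infty F t2 p2 w s2 -> s1 = s2.

Definition ratfun (F : fam) : Prop :=
  [/\ compatible F, piecewise_int_affine F & equal_slopes F].

(* elements of Rat(|Delta|): None = infinity *)
Definition inRat (G : option fam) : Prop :=
  if G is Some F then ratfun F else True.

(* tropical polynomials in r variables: finite lists of terms
   a (.) s_1^{e_1} (.) ... (.) s_r^{e_r}, a in Q; the empty list is infinity. *)
Definition tpoly (r : nat) := seq (rat * ('I_r -> nat)).

Definition tterm r (s : 'I_r -> fam) (a : rat) (e : 'I_r -> nat) (t : P) (u : V -> R) : R :=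
  ratr a + \sum_(j < r) (e j)%:R * s j t u.

Definition teval r (s : 'I_r -> fam) (p : tpoly r) (t : P) (u : V -> R) : option R :=
  match p with
  | [::] => None
  | x :: p' => Some (foldr (fun y acc => Num.min (tterm s y.1 y.2 t u) acc)
                           (tterm s x.1 x.2 t u) p')
  end.

Definition tquot r (s : 'I_r -> fam) (p q : tpoly r) (t : P) (u : V -> R) : option R :=
  match teval s p t u, teval s q t u with
  | Some a, Some b => Some (a - b)
  | _, _ => None
  end.

Definition Rat_finitely_generated : Prop :=
  exists r : nat, exists s : 'I_r -> fam,
    (forall j, ratfun (s j)) /\
    forall G : option fam, inRat G ->
      exists p q : tpoly r, q <> [::] /\
        forall t : P, inDelta t -> forall u, inTheta t u ->
          omap (fun F => F t u) G = tquot s p q t u.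

End APC.

(* Main.v *)
(* On the cone over |Delta|, a rational function F extends to a continuous
   piecewise linear homogeneous function: its value at a point of mass 0 is the
   slope near infinity in that direction, so equality of slopes along parallel
   half-lines is exactly well-definedness of the extension.

   The generators are phi_tau, equal to the minimum of the coordinates indexed
   by zeta tau on the cells above tau and to 0 on the others; the vertices tau
   give the coordinate functions.  If F equals an affine function f on a
   polyhedron C in Theta_t, then delta, the sum of the positive parts of the
   constraints defining C and of the phi_tau with tau not below t, vanishes
   exactly on C, and Farkas' lemma on the cones over the other pieces of F gives
   an N with f - N delta <= F everywhere.  As f - N delta = F on C, the function
   F is the maximum of these finitely many tropical quotients. *)

Require Import Defs.
From HB Require Import structures.
From mathcomp Require Import all_boot all_order all_algebra.
From mathcomp Require Import boolp reals.
From mathcomp Require Import ring lra.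

Set Implicit Arguments.
Unset Strict Implicit.
Unset Printing Implicit Defensive.

Import Order.TTheory GRing.Theory Num.Theory.
Local Open Scope ring_scope.

(** * Linear forms and a quantitative Farkas lemma *)

Section LinearForms.
Variables (R : realFieldType) (V : finType).
Implicit Types (a c l : {ffun V -> R}) (L : seq {ffun V -> R}) (x y : V -> R).

Definition dot a x : R := \sum_v a v * x v.

Lemma dotBl a c x : dot (a - c) x = dot a x - dot c x.
Proof.
by rewrite /dot -sumrB; apply: eq_bigr => v _; rewrite !ffunE mulrBl.
Qed.

Lemma dotDr a x y k : dot a (fun v => x v + k * y v) = dot a x + k * dot a y.
Proof.
rewrite /dot mulr_sumr -big_split; apply: eq_bigr => v _ /=.
by rewrite mulrDr mulrCA.
Qed.

Lemma dotZr a x k : dot a (fun v => k * x v) = k * dot a x.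
Proof. by rewrite /dot mulr_sumr; apply: eq_bigr => v _; rewrite mulrCA. Qed.

Definition violation L x : R :=
  \sum_(l <- L) Num.max 0 (dot l x).

Lemma violation_ge0 L x : 0 <= violation L x.
Proof. by apply: sumr_ge0 => l _; rewrite le_max lexx. Qed.

Lemma violation_cat L L' x :
  violation (L ++ L') x = violation L x + violation L' x.
Proof. exact: big_cat. Qed.

Lemma violation_eq0 L x :
  {in L, forall l, dot l x <= 0} -> violation L x = 0.
Proof.
move=> Lx; rewrite /violation big_seq big1 // => l /Lx.
by rewrite maxElt leNgt => /negbTE ->.
Qed.

(** The pullback of [a] along the map sending [x] to [x - l(x) x0], which for [l(x0) = 1] is the
    projection along [x0] onto the hyperplane [l = 0]. *)
Definition project l x0 a : {ffun V -> R} := [ffun v => a v - dot a x0 * l v].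

Lemma dot_project l x0 a x :
  dot (project l x0 a) x = dot a (fun v => x v + - dot l x * x0 v).
Proof.
rewrite dotDr mulNr mulrC /dot mulr_sumr -sumrB; apply: eq_bigr => v _.
by rewrite ffunE mulrBl mulrA.
Qed.

(* A quantitative Farkas lemma.  If dropping the constraint [l] breaks the
   implication, as witnessed by [x0], project along [x0] onto the hyperplane
   [l = 0] and induct on the number of constraints. *)
Lemma farkas_bound L c :
  (forall x, {in L, forall l, dot l x <= 0} -> dot c x <= 0) ->
  exists2 N, 0 <= N & forall x, dot c x <= N * violation L x.
Proof.
have [n] := ubnP (size L); elim: n L c => // n IH [|l L] c.
  by move=> _ cP; exists 0 => // x; rewrite mul0r cP.
rewrite ltnS /= => szL cP.
have viol_cons x : violation (l :: L) x = Num.max 0 (dot l x) + violation L x.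
  by rewrite /violation big_cons.
case: (pselect (forall x, {in L, forall l, dot l x <= 0} -> dot c x <= 0)).
  case/IH => // N N0 cN; exists N => // x; rewrite viol_cons mulrDr.
  by apply: le_trans (cN x) _; rewrite lerDr mulr_ge0 // le_max lexx.
move=> /existsNP[x0 /not_implyP[Lx0 /negP]]; rewrite -ltNge => cx0.
have lx0 : 0 < dot l x0.
  rewrite ltNge; apply/negP => lx0; suff: dot c x0 <= 0 by rewrite leNgt cx0.
  by apply: cP => a; rewrite inE => /predU1P[->|/Lx0].
pose k := (dot l x0)^-1; pose y0 v := k * x0 v.
have k0 : 0 < k by rewrite invr_gt0.
have ly0 : dot l y0 = 1 by rewrite dotZr mulVf ?gt_eqF.
have Ly0 a : a \in L -> dot a y0 <= 0.
  by move=> /Lx0 ax0; rewrite dotZr pmulr_rle0.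
have cy0 : 0 < dot c y0 by rewrite dotZr mulr_gt0.
have [||N N0 cN] := IH [seq project l y0 a | a <- L] (project l y0 c).
- by rewrite size_map.
- move=> x Lx; rewrite dot_project; apply: cP => a; rewrite inE.
  case/predU1P => [->|aL]; first by rewrite dotDr ly0 mulr1 subrr.
  by rewrite -dot_project; apply: Lx; apply: map_f.
(* [dot c x] is [c] at the projected point plus [dot l x * dot c y0]; [M] collects the factors of
   [Num.max 0 (dot l x)] in the bounds for these two terms. *)
pose M := N * \sum_(a <- L) - dot a y0 + dot c y0.
have SM : 0 <= \sum_(a <- L) - dot a y0.
  by rewrite big_seq sumr_ge0 // => a /Ly0; rewrite oppr_ge0.
have M0 : 0 <= M by rewrite addr_ge0 ?mulr_ge0 // ltW.
exists (N + M) => [|x]; first exact: addr_ge0.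
have -> : dot c x = dot (project l y0 c) x + dot l x * dot c y0.
  by rewrite dot_project dotDr mulNr subrK.
have {cN} := cN x.
(* Since [dot a y0 <= 0], projecting [x] along [y0] can raise [a] only when [dot l x > 0]. *)
have : violation [seq project l y0 a | a <- L] x <=
   violation L x + Num.max 0 (dot l x) * \sum_(a <- L) - dot a y0.
  rewrite /violation big_map mulr_sumr -big_split big_seq [leRHS]big_seq /=.
  apply: ler_sum => a /Ly0 ay0; rewrite dot_project dotDr.
  move: (dot l x) (dot a x) (dot a y0) ay0 => A B C C0.
  have [A0|A0] := lerP 0 A; have [B0|B0] := lerP 0 B;
    by rewrite ge_max; apply/andP; split; nra.
rewrite viol_cons; have := violation_ge0 L x.
have := violation_ge0 [seq project l y0 a | a <- L] x.
move: (violation _ x) (violation L x) => v' v v'0 v0 le_v' le_c.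
have {le_v'} := le_trans le_c (ler_wpM2l N0 le_v').
rewrite /M; move: SM; move: (\sum_(a <- L) _) => S SM.
move: (dot l x) (dot c y0) cy0 (dot _ x) => A B B0 C.
have NSv : 0 <= N * S * v by rewrite !mulr_ge0.
by have [A0|A0] := lerP 0 A => le_C; nra.
Qed.

End LinearForms.

(** * Closure properties of tropical quotients *)

Section TropicalQuotients.
Variables (R : realType) (d : Order.disp_t) (P : finPOrderType d)
  (V : finType) (Vf : {set V}) (zeta : P -> {set V})
  (r : nat) (s : 'I_r -> fam R P V).
Implicit Types (p q : tpoly r) (g h : fam R P V) (t : P) (u : V -> R).

(* Junk value: [tval [::] t u] is [0], not infinity. *)
Definition tval p t u : R :=
  if p is x :: p' then
    foldr (fun y acc => Num.min (tterm s y.1 y.2 t u) acc)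
      (tterm s x.1 x.2 t u) p'
  else 0.

Lemma tevalE p t u : p <> [::] -> teval s p t u = Some (tval p t u).
Proof. by case: p. Qed.

(** The fold in [tval] starts from the head of the list, so peeling off the head takes commutativity
    of [min]. *)
Lemma tval_cons x p t u : p <> [::] ->
  tval (x :: p) t u = Num.min (tterm s x.1 x.2 t u) (tval p t u).
Proof.
case: p => // y p _ /=; elim: p => [|z p IH] /=; first by rewrite minC.
by rewrite minCA IH minCA.
Qed.

Lemma tval_cat p q t u : p <> [::] -> q <> [::] ->
  tval (p ++ q) t u = Num.min (tval p t u) (tval q t u).
Proof.
elim: p => // x [|y p] IH _ q0; first by rewrite [LHS]tval_cons.
by rewrite [in LHS]tval_cons // -cat_cons IH // [in RHS]tval_cons // minA.
Qed.

Definition tmul (x y : rat * ('I_r -> nat)) : rat * ('I_r -> nat) :=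
  (x.1 + y.1, fun j => (x.2 j + y.2 j)%N).

Lemma tterm_tmul x y t u : tterm s (tmul x y).1 (tmul x y).2 t u =
  tterm s x.1 x.2 t u + tterm s y.1 y.2 t u.
Proof.
rewrite /tterm /= rmorphD addrACA -big_split; congr (_ + _).
by apply: eq_bigr => j _; rewrite natrD mulrDl.
Qed.

Definition tprod p q : tpoly r := flatten [seq map (tmul x) q | x <- p].

Lemma tval_map x q t u : q <> [::] ->
  tval (map (tmul x) q) t u = tterm s x.1 x.2 t u + tval q t u.
Proof.
elim: q => // y [|z q] IH _; first exact: tterm_tmul.
rewrite [map _ _]/= tval_cons // -[_ :: map _ _]/(map _ (z :: q)) IH //.
by rewrite tterm_tmul [in RHS]tval_cons // addr_minr.
Qed.

Lemma tprod_neq0 p q : p <> [::] -> q <> [::] -> tprod p q <> [::].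
Proof. by case: p => // x p _; case: q. Qed.

Lemma tval_tprod p q t u : p <> [::] -> q <> [::] ->
  tval (tprod p q) t u = tval p t u + tval q t u.
Proof.
elim: p => // x [|y p] IH _ q0.
  by rewrite /tprod /= cats0 tval_map.
rewrite -[tprod _ _]/(map (tmul x) q ++ tprod (y :: p) q).
rewrite tval_cat //; [|by case: (q) q0|exact: tprod_neq0].
by rewrite tval_map // IH // [in RHS]tval_cons // addr_minl.
Qed.

(** The finite elements of the semifield generated by [s], compared only on the cells of the
    complex. *)
Definition generated h : Prop :=
  exists p q, [/\ p <> [::], q <> [::] &
    forall t u, inDelta Vf zeta t -> inTheta Vf zeta t u ->
      h t u = tval p t u - tval q t u].

Lemma generated_eq g h : generated g ->
  (forall t u, inDelta Vf zeta t -> inTheta Vf zeta t u -> h t u = g t u) ->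
  generated h.
Proof.
by move=> [p [q [p0 q0 gE]]] hE; exists p, q; split=> // t u tD uT; rewrite hE ?gE.
Qed.

Lemma generated_cst (a : rat) : generated (fun _ _ => ratr a).
Proof.
exists [:: (a, fun=> 0%N)], [:: (0, fun=> 0%N)]; split=> // t u _ _.
by rewrite /= /tterm !big1 ?rmorph0 ?addr0 ?subr0 // => j _; rewrite mul0r.
Qed.

Lemma generated_gen j : generated (s j).
Proof.
exists [:: (0, fun i => i == j : nat)], [:: (0, fun=> 0%N)]; split=> // t u _ _.
rewrite /= /tterm [X in _ - (_ + X)]big1 => [|i _]; last by rewrite mul0r.
rewrite !rmorph0 !addr0 subr0 add0r (bigD1 j) //= eqxx mul1r big1 ?addr0 //.
by move=> i /negbTE ->; rewrite mul0r.
Qed.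

Lemma generatedN g : generated g -> generated (fun t u => - g t u).
Proof.
move=> [p [q [p0 q0 gE]]]; exists q, p; split=> // t u tD uT.
by rewrite gE // opprB.
Qed.

Lemma generatedD g h : generated g -> generated h ->
  generated (fun t u => g t u + h t u).
Proof.
move=> [p [q [p0 q0 gE]]] [p' [q' [p'0 q'0 hE]]].
exists (tprod p p'), (tprod q q'); split=> [||t u tD uT]; try exact: tprod_neq0.
by rewrite !tval_tprod // gE // hE // opprD addrACA.
Qed.

(** Addition of tropical fractions over the common denominator [tprod q q']. *)
Lemma generated_min g h : generated g -> generated h ->
  generated (fun t u => Num.min (g t u) (h t u)).
Proof.
move=> [p [q [p0 q0 gE]]] [p' [q' [p'0 q'0 hE]]].
have pq' := tprod_neq0 p0 q'0; have p'q := tprod_neq0 p'0 q0.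
exists (tprod p q' ++ tprod p' q), (tprod q q'); split=> [||t u tD uT].
- by case: (tprod p q') pq'.
- exact: tprod_neq0.
rewrite tval_cat // !tval_tprod // gE // hE // addr_minl.
by congr Num.min; ring.
Qed.

(** A maximum is the tropical inverse of the tropical sum of the inverses. *)
Lemma generated_max g h : generated g -> generated h ->
  generated (fun t u => Num.max (g t u) (h t u)).
Proof.
move=> gG hG; apply: (generated_eq (generatedN
  (generated_min (generatedN gG) (generatedN hG)))) => t u _ _.
by rewrite oppr_min !opprK.
Qed.

Lemma generated_sum I (L : seq I) (Q : pred I) (g : I -> fam R P V) :
  (forall i, generated (g i)) ->
  generated (fun t u => \sum_(i <- L | Q i) g i t u).
Proof.
move=> gG; elim: L => [|i L IH].
  by apply: (generated_eq (generated_cst 0)) => t u _ _; rewrite big_nil rmorph0.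
case Qi: (Q i).
  by apply: (generated_eq (generatedD (gG i) IH)) => t u _ _; rewrite big_cons Qi.
by apply: (generated_eq IH) => t u _ _; rewrite big_cons Qi.
Qed.

Lemma generatedMn g n : generated g -> generated (fun t u => n%:R * g t u).
Proof.
move=> gG; apply: (generated_eq (generated_sum (iota 0 n) predT (fun=> gG))) => t u _ _.
by rewrite big_const_seq count_predT size_iota iter_addr_0 mulr_natl.
Qed.

Lemma generatedMz g (m : int) : generated g -> generated (fun t u => m%:~R * g t u).
Proof.
case: m => n gG; first exact: generatedMn.
apply: (generated_eq (generatedN (generatedMn n.+1 gG))) => t u _ _.
by rewrite NegzE mulrNz mulNr.
Qed.

End TropicalQuotients.

(** * The generators and their membership in the function field *)

Section Generators.
Variables (R : realType) (d : Order.disp_t) (P : finPOrderType d)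
  (V : finType) (Vf : {set V}) (zeta : P -> {set V}).
Hypothesis apc : is_APC_with_fan Vf zeta.
Implicit Types (r t tau : P) (u w x : V -> R) (v : V) (S : {set V}).

Lemma zeta_le r t : (r <= t)%O -> zeta r \subset zeta t.
Proof. by case: apc => _ _ _ /(_ t)[_ _ + _]; apply. Qed.

Lemma le_zeta r1 r2 t : (r1 <= t)%O -> (r2 <= t)%O ->
  zeta r1 \subset zeta r2 -> (r1 <= r2)%O.
Proof. by case: apc => _ _ _ /(_ t)[_ + _ _] => H r1t r2t; rewrite (H r1 r2). Qed.

Lemma face_exists S t : S \subset zeta t -> exists2 r, (r <= t)%O & zeta r = S.
Proof. by case: apc => _ _ _ /(_ t)[_ _ _]; apply. Qed.

Lemma vertex_exists v : exists t, zeta t = [set v].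
Proof. by case: apc => _ _ /(_ v)[t [tv _]] _; exists t. Qed.

(** Some face of [t] has vertex set [[set v]], and uniqueness for singletons makes it [tau]. Larger
    vertex sets may be shared by several elements. *)
Lemma vertex_le v t tau : zeta tau = [set v] -> v \in zeta t -> (tau <= t)%O.
Proof.
move=> tauv; rewrite -sub1set => /face_exists[r rt rv].
case: apc => _ _ /(_ v)[t0 [_ t0U]] _.
by rewrite -(t0U _ tauv) (t0U _ rv).
Qed.

(** An element with empty vertex set lies below the minimum of [P], hence below every [t]. *)
Lemma zeta_nonempty tau t : ~~ (tau <= t)%O -> exists v, v \in zeta tau.
Proof.
move=> /negP tau_t; apply/set0Pn/negP => /eqP tau0; apply: tau_t.
case: apc => _ [z [zmin z0]] _ _.
by rewrite (le_trans _ (zmin t)) // (@le_zeta _ _ tau) // tau0 sub0set.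
Qed.

Lemma theta_le r t u : (r <= t)%O -> inDelta Vf zeta r ->
  inTheta Vf zeta r u -> inTheta Vf zeta t u.
Proof.
move=> rt rD [u0 uge0 u1]; have rtS := subsetP (zeta_le rt).
split=> [v vt|v vt|].
- by apply: u0; apply: contra vt; apply: rtS.
- by have [/uge0//|/u0->] := boolP (v \in zeta r).
rewrite -u1 [LHS](bigID (mem (zeta r))) /= [X in _ + X]big1 ?addr0.
  apply: eq_bigl => v; rewrite !inE.
  by have [/rtS->|] := boolP (v \in zeta r); rewrite ?andbT ?andbF.
by move=> v /andP[_ /u0].
Qed.

Lemma theta_ge0 t u v : inTheta Vf zeta t u -> 0 <= u v.
Proof. by move=> [u0 uge0 _]; have [/uge0//|/u0->] := boolP (v \in zeta t). Qed.

(** Coordinates cannot separate distinct cells with the same vertex set; this function can, as it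
    vanishes on cells not above [tau]. The inner 0 is a default for empty [zeta tau]. *)
Definition face_min tau t u : R :=
  if (tau <= t)%O then
    if [pick v in zeta tau] is Some v0
    then u [arg min_(v < v0 in zeta tau) u v]%O else 0
  else 0.

Lemma face_minP tau t u : (tau <= t)%O -> (exists v, v \in zeta tau) ->
  exists2 v, v \in zeta tau &
    face_min tau t u = u v /\ {in zeta tau, forall v', u v <= u v'}.
Proof.
rewrite /face_min => -> [v1 v1tau]; case: pickP => [v0 /= v0tau|/(_ v1)]; last first.
  by rewrite /= v1tau.
by case: arg_minP => // v vtau vmin; exists v.
Qed.

Lemma face_min_eq0 tau t u :
  ~~ (tau <= t)%O \/ zeta tau = set0 -> face_min tau t u = 0.
Proof.
rewrite /face_min => -[/negbTE->//|tau0]; case: ifP => // _; case: pickP => //.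
by move=> v; rewrite /= tau0 inE.
Qed.

Lemma face_min_le tau t u v : (tau <= t)%O -> v \in zeta tau ->
  face_min tau t u <= u v.
Proof.
by move=> tau_t vtau; have [|v' _ [-> ->]] := face_minP u tau_t; first by exists v.
Qed.

Lemma face_min_ge0 tau t u : (forall v, 0 <= u v) -> 0 <= face_min tau t u.
Proof.
move=> u0; have [tau_t|tau_t] := boolP (tau <= t)%O; last by rewrite face_min_eq0 //; left.
have [tau0|/set0Pn tau0] := eqVneq (zeta tau) set0.
  by rewrite face_min_eq0 //; right.
by have [v _ [-> _]] := face_minP u tau_t tau0.
Qed.

(* On [Theta_t] a face [tau <= t] that is not below [r] has a vertex outside
   [zeta r], where [u] vanishes. *)
Lemma face_min_theta0 tau r t u : (r <= t)%O -> ~~ (tau <= r)%O ->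
  (forall v, 0 <= u v) -> (forall v, v \notin zeta r -> u v = 0) ->
  face_min tau t u = 0.
Proof.
move=> rt tau_r uge0 u0; have [tau_t|tau_t] := boolP (tau <= t)%O; last first.
  by rewrite face_min_eq0 //; left.
have /subsetPn[v vtau vr] : ~~ (zeta tau \subset zeta r).
  by apply: contra tau_r; apply: le_zeta tau_t rt.
apply/eqP; rewrite eq_le face_min_ge0 // andbT.
by apply: le_trans (face_min_le u tau_t vtau) _; rewrite u0.
Qed.

Lemma face_min_compatible tau : compatible Vf zeta (face_min tau).
Proof.
move=> r t rD tD rt u uT; have [tau_r|tau_r] := boolP (tau <= r)%O.
  by rewrite /face_min tau_r (le_trans tau_r rt).
have [u0 _ _] := uT; rewrite [RHS]face_min_eq0; last by left.
by apply: face_min_theta0 rt tau_r _ u0 => v; apply: theta_ge0 uT.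
Qed.

Lemma face_min_vertex v tau t u : zeta tau = [set v] -> inTheta Vf zeta t u ->
  face_min tau t u = u v.
Proof.
move=> tauv [u0 _ _]; have [vt|vt] := boolP (v \in zeta t).
  have [|v'] := face_minP u (vertex_le tauv vt); first by exists v; rewrite tauv inE.
  by rewrite tauv inE => /eqP -> [].
rewrite u0 // face_min_eq0 //; left; apply: contra vt => /zeta_le/subsetP; apply.
by rewrite tauv inE.
Qed.

Lemma face_min_piecewise tau : piecewise_int_affine Vf zeta (face_min tau).
Proof.
move=> t tD; pose trivial := ~~ (tau <= t)%O || (zeta tau == set0).
have [triv|] := boolP trivial.
  exists 1%N, (fun=> [::]), (fun _ _ => 0), (fun=> 0); split=> [u _|i u _ _].
    by exists ord0.
  rewrite face_min_eq0; last by case/orP: triv => [|/eqP]; [left|right].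
  by rewrite /int_affine big1 ?add0r ?rmorph0 // => v _; rewrite mul0r.
rewrite negb_or negbK => /andP[tau_t /set0Pn tau0].
(* Piece [i] is the region where the [i]-th vertex of [tau] has the smallest coordinate. *)
pose Q (i : 'I_#|zeta tau|) : seq ((V -> rat) * rat) :=
  [seq (fun v => (v == enum_val i)%:R - (v == v')%:R, 0) | v' <- enum (zeta tau)].
have QP i u : in_poly (Q i) u <-> {in zeta tau, forall v, u (enum_val i) <= u v}.
  have sum1 (v : V) : \sum_v' (v' == v)%:R * u v' = u v.
    by rewrite (bigD1 v) //= eqxx mul1r big1 ?addr0 // => v' /negbTE ->; rewrite mul0r.
  have E v' : \sum_v ratr ((v == enum_val i)%:R - (v == v')%:R) * u v =
      u (enum_val i) - u v'.
    rewrite -[in RHS](sum1 (enum_val i)) -[in RHS](sum1 v') -sumrB.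
    by apply: eq_bigr => v _; rewrite rmorphB !rmorph_nat mulrBl.
  rewrite /in_poly all_map; split=> [/allP H v vtau|H].
    by have := H v; rewrite mem_enum => /(_ vtau); rewrite /= E rmorph0 subr_le0.
  by apply/allP => v; rewrite mem_enum => vtau; rewrite /= E rmorph0 subr_le0 H.
exists #|zeta tau|, Q, (fun i v => (v == enum_val i)%:R), (fun=> 0).
split=> [u _|i u _ /QP Qi].
  have [v vtau [_ vmin]] := face_minP u tau_t tau0.
  by exists (enum_rank_in vtau v); apply/QP; rewrite enum_rankK_in.
have [v vtau [-> vmin]] := face_minP u tau_t tau0.
have -> : u v = u (enum_val i).
  by apply/eqP; rewrite eq_le vmin ?enum_valP // Qi.
rewrite /int_affine (bigD1 (enum_val i)) //= eqxx mul1r.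
by rewrite big1 ?rmorph0 ?addr0 // => v' /negbTE ->; rewrite mul0r.
Qed.

Lemma bounded_slope_eq0 (a b c T : R) :
  (forall s, T <= s -> `|a * s + b| <= c) -> a = 0.
Proof.
move=> H; apply/eqP/negP => /negP a0; have a_gt0 : 0 < `|a| by rewrite normr_gt0.
(* At [|T| + k] the linear term is at least [c + |b| + 1] in absolute value, too large for the bound
   [c]. *)
pose k := (c + `|b| + 1) / `|a|.
have c0 : 0 <= c by apply: le_trans (H T (lexx _)).
have kE : `|a| * k = c + `|b| + 1 by rewrite /k mulrC divfK ?gt_eqF.
have k0 : 0 <= k by rewrite divr_ge0 // !addr_ge0.
have := H (`|T| + k); rewrite (le_trans (ler_norm T)) ?lerDl // => /(_ isT).
have : `|a * (`|T| + k)| <= `|a * (`|T| + k) + b| + `|b|.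
  by rewrite -[X in `|X| <= _](addrK b) (le_trans (ler_normB _ _)).
rewrite normrM [`|_ + k|]ger0_norm ?addr_ge0 // mulrDr kE.
by have := mulr_ge0 (ltW a_gt0) (normr_ge0 T); lra.
Qed.

(** Along the half-line the function stays within bounded distance of [s * face_min tau t w]: below
    because [p >= 0], above by evaluating at a vertex where [w] is minimal. *)
Lemma face_min_slope tau t p w (a : R) : halfline Vf zeta t p w ->
  slope_at_infty (face_min tau) t p w a -> a = face_min tau t w.
Proof.
move=> [tD pT wge0 _ _] [T [T0 aE]].
have pge0 v : 0 <= p v by apply: theta_ge0 pT.
have [C HC] : exists C, forall s, 0 <= s ->
    s * face_min tau t w <= face_min tau t (shift p w s) <= C + s * face_min tau t w.
  have [tau_t|tau_t] := boolP (tau <= t)%O; last first.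
    by exists 0 => s _; rewrite !face_min_eq0 ?mulr0 ?addr0 ?lexx //; left.
  have [tau0|/set0Pn tau0] := eqVneq (zeta tau) set0.
    by exists 0 => s _; rewrite !face_min_eq0 ?mulr0 ?addr0 ?lexx //; right.
  have [v vtau [-> vmin]] := face_minP w tau_t tau0.
  exists (p v) => s s0; rewrite (face_min_le (shift p w s) tau_t vtau) andbT.
  have [v' v'tau [-> _]] := face_minP (shift p w s) tau_t tau0.
  by rewrite /shift ler_wpDl // ler_wpM2l // vmin.
move: (face_min tau t w) (face_min tau t (shift p w T)) HC aE => f b HC aE.
apply/eqP; rewrite -subr_eq0; apply/eqP.
apply: (@bounded_slope_eq0 _ (b - a * T) C T) => s Ts.
have /HC : 0 <= s by apply: le_trans Ts.
by rewrite aE // ler_norml => /andP[]; nra.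
Qed.

(** Both slopes are values at [w], which is supported on [r]: they are the same minimum if
    [tau <= r], and both vanish otherwise. *)
Lemma face_min_equal_slopes tau : equal_slopes Vf zeta (face_min tau).
Proof.
move=> t1 t2 p1 p2 w s1 s2 h1 h2 [r [rt1 rt2 wr]].
move=> /(face_min_slope h1)-> /(face_min_slope h2)->.
have [_ _ w0 _ _] := h1.
have wr0 v : v \notin zeta r -> w v = 0.
  by move=> vr; apply/eqP; apply: contraNT vr; apply: wr.
have [tau_r|tau_r] := boolP (tau <= r)%O; last first.
  by rewrite !(@face_min_theta0 tau r).
by rewrite /face_min (le_trans tau_r rt1) (le_trans tau_r rt2).
Qed.

Lemma face_min_ratfun tau : ratfun Vf zeta (face_min tau).
Proof.
split; [exact: face_min_compatible|exact: face_min_piecewise|].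
exact: face_min_equal_slopes.
Qed.

End Generators.

(** The conditions persist for larger [n], so the maximum of the thresholds serves all [x] at
    once. *)
Lemma uniform_bound (T : finType) (Q : T -> nat -> Prop) :
  (forall x, exists N, forall n, (N <= n)%N -> Q x n) ->
  exists N, forall n, (N <= n)%N -> forall x, Q x n.
Proof.
move=> /fin_all_exists[N HN]; exists (\max_x N x)%N => n Nn x.
by apply/HN/(leq_trans _ Nn)/leq_bigmax.
Qed.

(** * Homogenization on the cone over the complex *)

Section Homogenization.
Variables (R : realType) (V : finType) (Vf : {set V}).
Implicit Types (u x : V -> R) (v : V).

Definition mass u : R := \sum_(v in Vf) u v.

(* The linear forms on the cone over [|Delta|] which restrict, on [mass = 1],
   to a given affine function or to the slack of a given constraint. *)
Definition hom_affine (m : V -> int) (g : rat) : {ffun V -> R} :=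
  [ffun v => (m v)%:~R + ratr g * (v \in Vf)%:R].

Definition hom_constr (c : (V -> rat) * rat) : {ffun V -> R} :=
  [ffun v => ratr (c.1 v) - ratr c.2 * (v \in Vf)%:R].

Definition unit_form v : {ffun V -> R} := [ffun x => (x == v)%:R].

Lemma sum_indicator (a : R) u : \sum_v a * (v \in Vf)%:R * u v = a * mass u.
Proof.
rewrite mulr_sumr [RHS]big_mkcond /=; apply: eq_bigr => v _.
by case: (v \in Vf); rewrite ?mulr1 ?mulr0 ?mul0r.
Qed.

Lemma dot_hom_affine m g u :
  dot (hom_affine m g) u = \sum_v (m v)%:~R * u v + ratr g * mass u.
Proof.
rewrite -sum_indicator -big_split; apply: eq_bigr => v _.
by rewrite ffunE mulrDl.
Qed.

Lemma dot_hom_constr c u :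
  dot (hom_constr c) u = \sum_v ratr (c.1 v) * u v - ratr c.2 * mass u.
Proof.
rewrite -sum_indicator -sumrB; apply: eq_bigr => v _.
by rewrite ffunE mulrBl.
Qed.

Lemma dot_unit_form v u : dot (unit_form v) u = u v.
Proof.
rewrite /dot (bigD1 v) //= ffunE eqxx mul1r big1 ?addr0 // => x /negbTE xv.
by rewrite ffunE xv mul0r.
Qed.

Lemma dot_hom_affine1 m g u : mass u = 1 ->
  dot (hom_affine m g) u = int_affine m g u.
Proof. by move=> u1; rewrite dot_hom_affine u1 mulr1. Qed.

Lemma in_polyE Q u : mass u = 1 ->
  in_poly Q u = all (fun l => dot l u <= 0) (map hom_constr Q).
Proof.
move=> u1; rewrite all_map; apply: eq_all => c /=.
by rewrite dot_hom_constr u1 mulr1 subr_le0.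
Qed.

End Homogenization.

(** * Generated minorants of a rational function *)

Section Minorants.
Variables (R : realType) (d : Order.disp_t) (P : finPOrderType d)
  (V : finType) (Vf : {set V}) (zeta : P -> {set V}).
Hypothesis apc : is_APC_with_fan Vf zeta.
Implicit Types (r t tau : P) (u w x : V -> R) (v : V) (F h : fam R P V).

Local Notation Theta := (@inTheta R d P V Vf zeta).
Local Notation Delta := (@inDelta d P V Vf zeta).
Local Notation hom Q := (map (hom_constr R Vf) Q).

(** The index runs over the fan as well: its rays give the coordinates outside [Vf]. *)
Definition gens (j : 'I_#|{: P}|) : fam R P V := face_min zeta (enum_val j).

Local Notation gen := (generated Vf zeta gens).

Lemma mass_face r u : (forall v, v \notin zeta r -> u v = 0) ->
  mass Vf u = \sum_(v in zeta r :&: Vf) u v.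
Proof.
move=> u0; rewrite /mass (bigID (mem (zeta r))) /= addrC big1 ?add0r.
  by apply: eq_bigl => v; rewrite !inE andbC.
by move=> v /andP[_ /u0].
Qed.

Lemma theta_mass t u : Theta t u -> mass Vf u = 1.
Proof. by move=> [u0 _ <-]; apply: mass_face. Qed.

Lemma gen_face_min tau : gen (face_min zeta tau).
Proof. by rewrite -(enum_rankK tau); apply: (generated_gen _ _ gens). Qed.

Lemma gen_coord v : gen (fun _ u => u v).
Proof.
have [tau tauv] := vertex_exists apc v.
apply: (generated_eq (gen_face_min tau)) => t u _ uT.
by rewrite (face_min_vertex apc tauv uT).
Qed.

Lemma gen_int_affine m g : gen (fun _ => int_affine m g).
Proof.
have mG v := generatedMz (m v) (gen_coord v).
by apply: (generated_eq (generatedD (generated_sum _ predT mG) (generated_cst _ _ _ g))).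
Qed.

Lemma common_denominator (a : V -> rat) :
  exists2 D : nat, (0 < D)%N & exists m : V -> int, forall v, D%:R * a v = (m v)%:~R.
Proof.
pose D := (\prod_v `|denq (a v)|)%N; exists D.
  by rewrite prodn_gt0 // => v; rewrite absz_gt0 denq_neq0.
suff /fin_all_exists : forall v, exists k : int, D%:R * a v = k%:~R by [].
move=> v; exists (numq (a v) * (\prod_(x | x != v) `|denq (a x)|)%N%:Z).
rewrite /D (bigD1 v) //= natrM rmorphM /= numqE natr_absz gtr0_norm ?denq_gt0 //.
by rewrite -pmulrn; ring.
Qed.

(** Constraints have rational coefficients, generated affine functions integral ones. Scaling by a
    common denominator [D >= 1] keeps the zero set and can only enlarge the positive part. *)
Lemma gen_constr (c : (V -> rat) * rat) : exists h, [/\ gen h,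
    forall t u, Theta t u -> Num.max 0 (dot (hom_constr R Vf c) u) <= h t u &
    forall t u, Theta t u -> dot (hom_constr R Vf c) u <= 0 -> h t u = 0].
Proof.
have [D D0 [m mE]] := common_denominator c.1.
have E t u : Theta t u ->
    int_affine m (- (D%:R * c.2)) u = D%:R * dot (hom_constr R Vf c) u.
  move=> /theta_mass u1; rewrite dot_hom_constr u1 mulr1 mulrBr mulr_sumr.
  rewrite /int_affine rmorphN rmorphM /= ratr_nat; congr (_ - _).
  apply: eq_bigr => v _; rewrite mulrA -(ratr_int _ (m v)) -mE rmorphM /=.
  by rewrite ratr_nat.
exists (fun _ u => Num.max 0 (int_affine m (- (D%:R * c.2)) u)); split.
- apply: (generated_max (g:=fun _ _ => 0) _ (gen_int_affine _ _)).
  by apply: (generated_eq (generated_cst _ _ _ 0)) => t u _ _; rewrite rmorph0.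
- move=> t u /E ->; have D1 : 1 <= D%:R :> R by rewrite ler1n.
  case: (lerP 0 (dot _ u)) => cu; last by rewrite le_max lexx.
  by rewrite le_max ler_peMl ?orbT.
- move=> t u /E -> cu; apply/max_idPl.
  by rewrite mulr_ge0_le0.
Qed.

Lemma gen_violation Q : exists h, [/\ gen h,
    forall t u, Theta t u -> violation (hom Q) u <= h t u &
    forall t u, Theta t u -> in_poly Q u -> h t u = 0].
Proof.
elim: Q => [|c Q [h [hG hge h0]]].
  exists (fun _ _ => 0); split=> //.
    by apply: (generated_eq (generated_cst _ _ _ 0)) => t u _ _; rewrite rmorph0.
  by move=> t u _; rewrite /violation big_nil.
have [k [kG kge k0]] := gen_constr c.
exists (fun t u => k t u + h t u); split; first exact: generatedD.
  by move=> t u uT; rewrite /violation big_cons lerD ?kge ?hge.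
move=> t u uT; have u1 := theta_mass uT; rewrite (in_polyE _ u1) /= -(in_polyE _ u1).
by move=> /andP[/(k0 _ _ uT)-> /(h0 _ _ uT)->]; rewrite addr0.
Qed.

Definition affine_on F t (Q : seq ((V -> rat) * rat)) m g : Prop :=
  forall u, Theta t u -> in_poly Q u -> F t u = int_affine m g u.

(** The homogenized constraints make [w] a recession direction of the piece, so the half-line stays
    in it and [F] remains affine there. As [w] has mass 0, the homogenized form at [w] is the linear
    part. *)
Lemma recession_halfline F t Q m g p w : Delta t -> affine_on F t Q m g ->
    Theta t p -> in_poly Q p -> (forall v, 0 <= w v) ->
    (forall v, w v != 0 -> (v \in zeta t) && (v \notin Vf)) ->
    (exists v, w v != 0) -> all (fun l => dot l w <= 0) (hom Q) ->
  halfline Vf zeta t p w /\ slope_at_infty F t p w (dot (hom_affine R Vf m g) w).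
Proof.
move=> tD FQ pT pQ w0 wt wn wQ; split=> //.
have [p0 pge p1] := pT.
have sT s : 0 <= s -> Theta t (shift p w s).
  move=> s0; split=> [v vt|v vt|].
  - rewrite /shift p0 // add0r; apply/eqP; rewrite mulf_eq0 orbC -[_ || _]negbK negb_or.
    by apply: contra vt => /andP[/wt/andP[]].
  - by rewrite addr_ge0 ?mulr_ge0 ?pge.
  rewrite -p1; apply: eq_bigr => v; rewrite inE => /andP[_ vf].
  rewrite /shift; have [->|/wt] := eqVneq (w v) 0; first by rewrite mulr0 addr0.
  by rewrite vf andbF.
have sQ s : 0 <= s -> in_poly Q (shift p w s).
  move=> s0; rewrite (in_polyE _ (theta_mass (sT s s0))).
  move: pQ; rewrite (in_polyE _ (theta_mass pT)) => /allP pQ.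
  apply/allP => l lQ; rewrite dotDr -[leRHS]addr0 lerD ?pQ //.
  by rewrite mulr_ge0_le0 // (allP wQ).
have E s (s0 : 0 <= s) : F t (shift p w s) = dot (hom_affine R Vf m g) (shift p w s).
  by rewrite (FQ _ (sT s s0) (sQ s s0)) (dot_hom_affine1 _ _ (theta_mass (sT s s0))).
by exists 0; split=> // s s0; rewrite !E // !dotDr mul0r addr0 subr0 mulrC.
Qed.

(* Two pieces of [F] have the same homogenization on a common face of their
   cones: for [mass x != 0] by compatibility at [x / mass x], and for
   [mass x = 0] because it computes there the slope near infinity along [x]. *)
Lemma pieces_agree F t1 t2 Q1 Q2 m1 m2 g1 g2 p1 p2 r x :
    ratfun Vf zeta F -> Delta t1 -> Delta t2 ->
    affine_on F t1 Q1 m1 g1 -> affine_on F t2 Q2 m2 g2 ->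
    Theta t1 p1 -> in_poly Q1 p1 -> Theta t2 p2 -> in_poly Q2 p2 ->
    (r <= t1)%O -> (r <= t2)%O ->
    (forall v, 0 <= x v) -> (forall v, v \notin zeta r -> x v = 0) ->
    all (fun l => dot l x <= 0) (hom Q1) -> all (fun l => dot l x <= 0) (hom Q2) ->
  dot (hom_affine R Vf m1 g1) x = dot (hom_affine R Vf m2 g2) x.
Proof.
move=> [Fc _ Fs] t1D t2D F1 F2 p1T p1Q p2T p2Q rt1 rt2 x0 xr xQ1 xQ2.
have [mx0|mx0] := eqVneq (mass Vf x) 0; last first.
  pose k := (mass Vf x)^-1; pose y v := k * x v.
  have kgt0 : 0 < k by rewrite invr_gt0 lt_def mx0 sumr_ge0.
  have my : mass Vf y = 1 by rewrite /mass -mulr_sumr mulVf.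
  have yr v : v \notin zeta r -> y v = 0 by rewrite /y => /xr->; rewrite mulr0.
  have rD : Delta r.
    apply: contraNneq mx0 => r0; by rewrite (mass_face xr) r0 big_set0.
  have yT : Theta r y.
    split=> // [v _|]; first by rewrite mulr_ge0 // ltW.
    by rewrite -(mass_face yr).
  have yQ Q : all (fun l => dot l x <= 0) (hom Q) -> in_poly Q y.
    move=> /allP xQ; rewrite (in_polyE _ my); apply/allP => l /xQ.
    by rewrite dotZr pmulr_rle0.
  apply: (mulfI (lt0r_neq0 kgt0)); rewrite -!dotZr !(dot_hom_affine1 _ _ my).
  have yT1 := theta_le apc rt1 rD yT; have yT2 := theta_le apc rt2 rD yT.
  by rewrite -(F1 _ yT1 (yQ _ xQ1)) -(F2 _ yT2 (yQ _ xQ2)) !(Fc r).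
have [x_eq0|] := boolP [forall v, x v == 0].
  have E a : dot a x = 0.
    by rewrite /dot big1 // => v _; rewrite (eqP (forallP x_eq0 v)) mulr0.
  by rewrite !E.
rewrite negb_forall => /existsP xn.
have xf v : v \in Vf -> x v = 0.
  move=> vf; apply/eqP; move: mx0 => /eqP; rewrite psumr_eq0 //.
  by move=> /allP/(_ v); rewrite mem_index_enum vf; apply.
have xS t : (r <= t)%O -> forall v, x v != 0 -> (v \in zeta t) && (v \notin Vf).
  move=> rt v xv; apply/andP; split; last by apply: contraNN xv => /xf->.
  by apply: (subsetP (zeta_le apc rt)); apply: contraNT xv => /xr->.
have [h1 s1] := recession_halfline t1D F1 p1T p1Q x0 (xS _ rt1) xn xQ1.
have [h2 s2] := recession_halfline t2D F2 p2T p2Q x0 (xS _ rt2) xn xQ2.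
apply: Fs h1 h2 _ s1 s2; exists r; split=> // v; apply: contraNT => /xr->.
by rewrite eqxx.
Qed.

(* Pick a vertex [sigma tau] of each face [tau] of [t'] that is not below [t].
   The conditions [u (sigma tau) <= 0] cut out of [Theta_t'] a common face of
   [t] and [t'], so that they can stand in for the non-convex condition
   [u \in Theta_t] in Farkas' lemma. *)
Lemma piece_bound F t t' Q Q' m m' g g' p p' (sigma : P -> V) :
    ratfun Vf zeta F -> Delta t -> Delta t' ->
    affine_on F t Q m g -> affine_on F t' Q' m' g' ->
    Theta t p -> in_poly Q p -> Theta t' p' -> in_poly Q' p' ->
    (forall tau, ~~ (tau <= t)%O -> sigma tau \in zeta tau) ->
  exists2 N, 0 <= N & forall u, Theta t' u -> in_poly Q' u ->
    int_affine m g u - N * (violation (hom Q) u +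
      \sum_(tau | (tau <= t')%O && ~~ (tau <= t)%O) u (sigma tau)) <= F t' u.
Proof.
move=> rF tD t'D FQ FQ' pT pQ p'T p'Q sigmaP.
pose bad tau := (tau <= t')%O && ~~ (tau <= t)%O.
(* On [Theta t'] the lists [Lnn] and [Lout] are satisfied, as is [hom Q'] on the piece; only [hom Q]
   and [Lsig] contribute to the final bound. *)
pose Lnn := [seq 0 - unit_form R v | v <- enum V].
pose Lout := [seq unit_form R v | v <- enum (~: zeta t')].
pose Lsig := [seq unit_form R (sigma tau) | tau <- enum bad].
pose c := hom_affine R Vf m g - hom_affine R Vf m' g'.
have dot0 u : dot 0 u = 0 by rewrite /dot big1 // => v _; rewrite ffunE mul0r.
have [x|N N0 NP] := @farkas_bound _ _ (Lnn ++ Lout ++ hom Q' ++ hom Q ++ Lsig) c.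
  move=> Lx.
  have x_ge0 v : 0 <= x v.
    have vL : 0 - unit_form R v \in Lnn by apply/mapP; exists v; rewrite ?mem_enum.
    have := Lx (0 - unit_form R v); rewrite mem_cat vL => /(_ isT).
    by rewrite dotBl dot0 dot_unit_form sub0r oppr_le0.
  have x_out v : v \notin zeta t' -> x v = 0.
    move=> vt; have vL : unit_form R v \in Lout.
      by apply/mapP; exists v; rewrite ?mem_enum ?inE.
    apply/eqP; rewrite eq_le x_ge0 andbT -dot_unit_form Lx //.
    by rewrite !mem_cat vL !orbT.
  have x_sig tau : bad tau -> x (sigma tau) = 0.
    move=> tau_bad; have tauL : unit_form R (sigma tau) \in Lsig.
      by apply/mapP; exists tau; rewrite ?mem_enum.
    apply/eqP; rewrite eq_le x_ge0 andbT -dot_unit_form Lx //.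
    by rewrite !mem_cat tauL !orbT.
  have xQ' : all (fun l => dot l x <= 0) (hom Q').
    by apply/allP => l lQ; apply: Lx; rewrite !mem_cat lQ !orbT.
  have xQ : all (fun l => dot l x <= 0) (hom Q).
    by apply/allP => l lQ; apply: Lx; rewrite !mem_cat lQ !orbT.
  have [|r rt' rE] := @face_exists _ _ _ _ _ apc
    (zeta t' :\: [set sigma tau | tau in bad]) t'; first exact: subsetDl.
  (* Otherwise [r] is itself bad, so [sigma r] was removed from [zeta r], although it belongs to
     it. *)
  have rt : (r <= t)%O.
    apply/negPn/negP => rt; have := sigmaP _ rt.
    by rewrite rE inE imset_f // unfold_in rt' rt.
  have xr v : v \notin zeta r -> x v = 0.
    rewrite rE inE negb_and negbK => /orP[/imsetP[tau tau_bad ->]|/x_out//].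
    exact: x_sig.
  by rewrite dotBl (pieces_agree rF tD t'D FQ FQ' pT pQ p'T p'Q rt rt') ?subrr.
exists N => // u uT uQ; have u0 v := theta_ge0 v uT.
have u1 := theta_mass uT; rewrite (FQ' u uT uQ).
have := NP u; rewrite !violation_cat (violation_eq0 (L := Lnn)); last first.
  by move=> _ /mapP[v _ ->]; rewrite dotBl dot0 dot_unit_form sub0r oppr_le0.
rewrite (violation_eq0 (L := Lout)); last first.
  move=> _ /mapP[v + ->]; rewrite mem_enum inE dot_unit_form.
  by have [uz _ _] := uT => /uz ->.
rewrite (violation_eq0 (L := hom Q')); last first.
  by apply/allP; rewrite -in_polyE.
have -> : violation Lsig u = \sum_(tau | bad tau) u (sigma tau).
  rewrite /violation big_map big_enum; apply: eq_bigr => tau _.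
  by rewrite dot_unit_form; apply/max_idPr.
rewrite !add0r /c dotBl !(dot_hom_affine1 _ _ u1).
by rewrite lerBlDl -lerBlDr.
Qed.

Definition minorant F h : Prop :=
  gen h /\ forall t u, Delta t -> Theta t u -> h t u <= F t u.

Lemma natural_bound (N : R) : exists n : nat, N <= n%:R.
Proof.
exists (Num.bound `|N|); apply: le_trans (ler_norm N) _.
exact/ltW/archi_boundP.
Qed.

(** The minorant is the affine function minus [N * (k + off)]: [k] penalizes violating [Q], [off]
    penalizes leaving [Theta t], and both vanish on the piece. *)
Lemma piece_minorant F t Q m g p :
    ratfun Vf zeta F -> Delta t -> affine_on F t Q m g ->
    Theta t p -> in_poly Q p ->
  exists h, minorant F h /\ forall u, Theta t u -> in_poly Q u -> h t u = F t u.
Proof.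
move=> rF tD FQ pT pQ; have [k [kG kge k0]] := gen_violation Q.
pose off (t' : P) u := \sum_(tau | ~~ (tau <= t)%O) face_min zeta tau t' u.
have offG : gen off by apply: generated_sum => tau; apply: gen_face_min.
have [N NP] : exists N, forall n, (N <= n)%N -> forall t', Delta t' ->
    forall u, Theta t' u -> int_affine m g u - n%:R * (k t' u + off t' u) <= F t' u.
  apply: uniform_bound => t'; have [t'D|_] := boolP (Delta t'); last by exists 0%N.
  have [_ /(_ t' t'D)[n' [Q' [m' [g' [Qcov FQ']]]]] _] := rF.
  (* Fixing [sigma] before [u] leaves finitely many bounds to make uniform. *)
  suff [N NP] : exists N, forall n, (N <= n)%N ->
      forall (i : 'I_n') (sigma : {ffun P -> V}),
      (forall tau, ~~ (tau <= t)%O -> sigma tau \in zeta tau) ->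
      forall u, Theta t' u -> in_poly (Q' i) u ->
      int_affine m g u - n%:R * (violation (hom Q) u +
        \sum_(tau | (tau <= t')%O && ~~ (tau <= t)%O) u (sigma tau)) <= F t' u.
    exists N => n Nn _ u uT; have [i ui] := Qcov u uT.
    (* For the given [u], choose vertices attaining the minima, so that the sum in the bound becomes
       [off]. *)
    have [sigma sigmaP] : exists sigma : P -> V, forall tau, ~~ (tau <= t)%O ->
        sigma tau \in zeta tau /\
        ((tau <= t')%O -> face_min zeta tau t' u = u (sigma tau)).
      apply: (@fin_all_exists P (fun=> V) (fun tau v => ~~ (tau <= t)%O ->
        v \in zeta tau /\ ((tau <= t')%O -> face_min zeta tau t' u = u v))) => tau.
      have [_|tau_t] := boolP (tau <= t)%O.
        by have [/set0Pn[v _] _ _ _] := apc; exists v.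
      have tau0 := zeta_nonempty apc tau_t.
      have [tau_t'|tau_t'] := boolP (tau <= t')%O.
        by have [v vtau [vE _]] := face_minP u tau_t' tau0; exists v.
      by have [v vtau] := tau0; exists v.
    have := NP n Nn i [ffun tau => sigma tau] _ u uT ui; move=> NPu.
    apply: le_trans (NPu _); last by move=> tau /sigmaP[]; rewrite ffunE.
    rewrite lerD2l lerN2 ler_wpM2l // lerD ?kge // /off.
    rewrite [leRHS](bigID (fun tau => tau <= t')%O) /= [X in _ <= _ + X]big1 ?addr0.
      rewrite le_eqVlt; apply/orP; left; apply/eqP.
      apply: eq_big => [tau|tau]; first by rewrite andbC.
      by move=> /andP[tau_t' /sigmaP[_ ->]] //; rewrite ffunE.
    by move=> tau /andP[_ tau_t']; rewrite face_min_eq0 //; left.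
  apply: uniform_bound => i; apply: uniform_bound => sigma.
  have [[p' [p'T p'Q]]|nop] := pselect (exists p', Theta t' p' /\ in_poly (Q' i) p').
    have [sigmaP|nosigma] := pselect (forall tau, ~~ (tau <= t)%O -> sigma tau \in zeta tau).
      have [N N0 NP] := piece_bound rF tD t'D FQ (FQ' i) pT pQ p'T p'Q sigmaP.
      have [n0 Nn0] := natural_bound N; exists n0 => n n0n _ u uT uQ.
      apply: le_trans (NP u uT uQ); rewrite lerD2l lerN2 ler_wpM2r //.
        rewrite addr_ge0 ?violation_ge0 // sumr_ge0 // => tau _.
        exact: theta_ge0 uT.
      by apply: le_trans Nn0 _; rewrite ler_nat.
    by exists 0%N.
  (* An empty piece offers no base point for [piece_bound], but the claim is vacuous there. *)
  by exists 0%N => n _ _ u uT uQ; case: nop; exists u.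
exists (fun t' u => int_affine m g u - N%:R * (k t' u + off t' u)); split; first split.
- apply: generatedD (gen_int_affine m g) _; apply: generatedN.
  by apply: generatedMn; apply: generatedD.
- by move=> t' u t'D uT; apply: NP.
move=> u uT uQ; rewrite FQ // k0 // /off big1 => [|tau tau_t].
  by rewrite addr0 mulr0 subr0.
have [u0 _ _] := uT.
by apply: (face_min_theta0 apc (lexx t) tau_t _ u0) => v; apply: theta_ge0 uT.
Qed.

(** Minorants are closed under [max], and one that touches [F] at a point forces equality there;
    [h0] replaces the maximum over the empty list. *)
Lemma max_minorant (T : finType) F (S : T -> P -> (V -> R) -> Prop) h0 :
    minorant F h0 ->
    (forall i, exists h, minorant F h /\
       forall t u, Delta t -> Theta t u -> S i t u -> h t u = F t u) ->
  exists h, minorant F h /\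
    forall i t u, Delta t -> Theta t u -> S i t u -> h t u = F t u.
Proof.
move=> h0F hF; suff [h [hm hE]] : exists h, minorant F h /\
    forall i, i \in enum T -> forall t u, Delta t ->
      Theta t u -> S i t u -> h t u = F t u.
  by exists h; split=> // i; apply: hE; rewrite mem_enum.
elim: (enum T) => [|i L [h [[hG hle] hE]]]; first by exists h0.
have [k [[kG kle] kE]] := hF i; exists (fun t u => Num.max (k t u) (h t u)).
split; first split; first exact: generated_max.
  by move=> t u tD uT; rewrite ge_max kle ?hle.
move=> j; rewrite inE => /predU1P[->|jL] t u tD uT uS.
  by rewrite (kE _ _ tD uT uS); apply/max_idPl/hle.
by rewrite (hE _ jL _ _ tD uT uS); apply/max_idPr/kle.
Qed.

Lemma theta_nonempty t : Delta t -> exists p, Theta t p.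
Proof.
move=> /set0Pn[v]; rewrite inE => /andP[vt vf]; exists (fun v' => (v' == v)%:R).
split=> [v' v't||].
- by case: eqP v't => // ->; rewrite vt.
- by move=> v' _.
- rewrite (bigD1 v) ?inE ?vt //= eqxx big1 ?addr0 // => v' /andP[_ /negbTE->].
  by [].
Qed.

Lemma simplex_minorant F t : ratfun Vf zeta F -> Delta t ->
  exists h, minorant F h /\ forall u, Theta t u -> h t u = F t u.
Proof.
move=> rF tD; have [_ /(_ t tD)[n [Q [m [g [Qcov FQ]]]]] _] := rF.
have [p pT] := theta_nonempty tD; have [i0 pi0] := Qcov p pT.
have [h0 [h0F _]] := piece_minorant rF tD (FQ i0) pT pi0.
have [i|h [hF hE]] := @max_minorant _ F
    (fun i t' u => t' = t /\ in_poly (Q i) u) h0 h0F; last first.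
  exists h; split=> // u uT; have [i ui] := Qcov u uT.
  exact: (hE i t u tD uT).
have [[q [qT qQ]]|noq] := pselect (exists q, Theta t q /\ in_poly (Q i) q).
  have [h [hF hE]] := piece_minorant rF tD (FQ i) qT qQ.
  by exists h; split=> // t' u _ + [t't uQ]; rewrite t't => uT; apply: hE.
exists h0; split=> // t' u _ + [t't uQ]; rewrite t't => uT.
by case: noq; exists u.
Qed.

Lemma ratfun_generated F : ratfun Vf zeta F -> gen F.
Proof.
move=> rF; have [/set0Pn[v vf] _ _ _] := apc.
have [t0 t0v] := vertex_exists apc v.
have t0D : Delta t0 by apply/set0Pn; exists v; rewrite inE t0v inE eqxx.
have [h0 [h0F _]] := simplex_minorant rF t0D.
have [t|h [[hG _] hE]] := @max_minorant P F (fun t t' _ => t' = t) h0 h0F.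
  have [tD|tD] := boolP (Delta t).
    have [h [hF hE]] := simplex_minorant rF tD.
    by exists h; split=> // t' u _ + t't; rewrite t't; apply: hE.
  by exists h0; split=> // t' u + _ t't; rewrite t't (negbTE tD).
by apply: (generated_eq hG) => t u tD uT; rewrite (hE t).
Qed.

End Minorants.

Theorem theorem1p2 (R : realType) (d : Order.disp_t) (P : finPOrderType d)
  (V : finType) (Vf : {set V}) (zeta : P -> {set V}) :
  is_APC_with_fan Vf zeta ->
  Rat_finitely_generated R Vf zeta.
Proof.
move=> apc; exists #|{: P}|, (@gens R d P V zeta).
split=> [j|[F|] GR]; first exact: face_min_ratfun.
  have [p [q [p0 q0 FE]]] := ratfun_generated apc GR.
  exists p, q; split=> // t tD u uT.
  by rewrite /tquot !tevalE //= FE.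
(* Infinity is the empty numerator over the constant 0. *)
by exists [::], [:: (0, fun=> 0%N)].
Qed.
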